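(* Let $R$ be a commutative ring with identity and let $\varphi:M_1\to M_2$ be an epimorphism of $R$-modules. Then: (1) If $N$ is a quasi $J$-submodule of $M_1$ with $\ker(\varphi)\subseteq N$, then $\varphi(N)$ is a quasi $J$-submodule of $M_2$. (2) If $K$ is a quasi $J$-submodule of $M_2$ and $\ker(\varphi)\subseteq J(R)M_1$, then $\varphi^{-1}(K)$ is a quasi $J$-submodule of $M_1$.
   Context: All rings are commutative with identity and all modules are unital. $J(R)$ is the Jacobson radical of $R$. For a submodule $N$ of an $R$-module $M$, $(N:M)=\{r\in R: rM\subseteq N\}$. A proper submodule $P$ of $M$ is prime if $rm\in P$ ($r\in R$, $m\in M$) implies $m\in P$ or $r\in(P:M)$. $M\text{-}rad(N)$ is the intersection of all prime submodules of $M$ containing $N$ (an empty intersection being $M$). A proper submodule $N$ of $M$ is a quasi $J$-submodule if whenever $r\in R$, $m\in M$ with $rm\in N$ and $r\notin (J(R)M:M)$, then $m\in M\text{-}rad(N)$. *)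

(* Defs.v *)
From HB Require Import structures.
From mathcomp Require Import all_boot all_order all_algebra.
From mathcomp Require Import all_classical.

Set Implicit Arguments.
Unset Strict Implicit.
Unset Printing Implicit Defensive.

Import GRing.Theory.

Local Open Scope ring_scope.
Local Open Scope classical_set_scope.

(* A submodule is an arbitrary classical set, not a decidable predicate.
   Rings are comPzRingType rather than comNzRingType so that the zero ring is
   allowed. *)

Definition submodule (R : pzRingType) (M : lmodType R) (N : set M) : Prop :=
  submod_closed (mem N).

Definition proper_submodule (R : pzRingType) (M : lmodType R) (N : set M) :
    Prop :=
  submodule N /\ N <> [set: M].

(* Ideals of R are the submodules of the regular module R^o. *)
Definition ideal (R : comPzRingType) (I : set R) : Prop :=
  @submodule R R^o I.

Definition maximal_ideal (R : comPzRingType) (I : set R) : Prop :=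
  [/\ ideal I, I <> [set: R] &
      forall J : set R, ideal J -> I `<=` J -> J = I \/ J = [set: R]].

Definition jacobson (R : comPzRingType) : set R :=
  \bigcap_(I in [set I : set R | maximal_ideal I]) I.
Arguments jacobson R : clear implicits.

(* The submodule I M: all finite sums of products a *: m, a in I, m in M. *)
Definition ideal_mul (R : comPzRingType) (I : set R) (M : lmodType R) :
    set M :=
  [set x | exists n (a : 'I_n -> R) (m : 'I_n -> M),
      (forall i, I (a i)) /\ x = \sum_(i < n) a i *: m i].
Arguments ideal_mul {R} I M.

(* The residual (N : M). *)
Definition colon (R : comPzRingType) (M : lmodType R) (N : set M) : set R :=
  [set r | forall m : M, N (r *: m)].

Definition prime_submodule (R : comPzRingType) (M : lmodType R) (P : set M) :
    Prop :=
  proper_submodule P /\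
  forall (r : R) (m : M), P (r *: m) -> P m \/ colon P r.

(* If no prime submodule contains N, this intersection is all of M. *)
Definition mrad (R : comPzRingType) (M : lmodType R) (N : set M) : set M :=
  \bigcap_(P in [set P : set M | prime_submodule P /\ N `<=` P]) P.

Definition quasi_J_submodule (R : comPzRingType) (M : lmodType R)
    (N : set M) : Prop :=
  proper_submodule N /\
  forall (r : R) (m : M),
    N (r *: m) -> ~ colon (ideal_mul (jacobson R) M) r -> mrad N m.

Definition kernel (R : comPzRingType) (M1 M2 : lmodType R)
    (phi : {linear M1 -> M2}) : set M1 :=
  phi @^-1` [set 0].

(* Main.v *)
(** The proof rests on the correspondence between the prime submodules of [M2]
    and those of [M1] containing the kernel, together with
    [phi (J(R) M1) = J(R) M2]. When the kernel lies in [J(R) M1] this gives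
    [(J(R) M1 : M1) = (J(R) M2 : M2)]; in general only the first residual is
    contained in the second, which is all that part (1) needs. *)
Require Import Defs.
From HB Require Import structures.
From mathcomp Require Import all_boot all_order all_algebra.
From mathcomp Require Import all_classical.

Import GRing.Theory.

Local Open Scope ring_scope.
Local Open Scope classical_set_scope.

(** [submod_closed] concerns boolean membership in [mem N]; this form lets the later proofs work
    with propositional membership. *)
Lemma submoduleP (R : pzRingType) (M : lmodType R) (N : set M) :
  submodule N <->
  N 0 /\ forall (a : R) (u v : M), N u -> N v -> N (a *: u + v).
Proof.
split=> -[N0 NZD]; split.
- by move: N0; rewrite !inE.
- by move=> a u v Nu Nv; have := NZD a u v; rewrite !inE; apply.
- by rewrite !inE.
- by move=> a u v; rewrite !inE; apply: NZD.
Qed.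

Lemma submoduleD {R : pzRingType} {M : lmodType R} {N : set M} {u v : M} :
  submodule N -> N u -> N v -> N (u + v).
Proof. by move=> /submoduleP[_ NZD] Nu Nv; rewrite -[u]scale1r; apply: NZD. Qed.

Lemma ideal_mulD {R : comPzRingType} {I : set R} {M : lmodType R} {u v : M} :
  ideal_mul I M u -> ideal_mul I M v -> ideal_mul I M (u + v).
Proof.
move=> [n [a [x [Ia ->]]]] [k [b [y [Ib ->]]]].
(* The two families are concatenated; [split] tells which half of the index range an index belongs
   to. *)
exists (n + k)%N.
exists (fun i => match fintype.split i with inl j => a j | inr j => b j end).
exists (fun i => match fintype.split i with inl j => x j | inr j => y j end).
split=> [i|]; first by case: fintype.split.
rewrite big_split_ord /=; congr (_ + _); apply: eq_bigr => i _.
- by rewrite (unsplitK (inl i)).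
- by rewrite (unsplitK (inr i)).
Qed.

Section Epimorphism.
Context {R : comPzRingType} {M1 M2 : lmodType R} {phi : {linear M1 -> M2}}.

Lemma kernel_sub (u v : M1) : phi u = phi v -> kernel phi (u - v).
Proof. by move=> uv; rewrite /kernel /= linearB uv subrr. Qed.

(** Two elements with the same image differ by an element of the kernel, which [N] absorbs. This is
    how membership in an image is pulled back throughout. *)
Lemma image_kernelP {N : set M1} {u : M1} :
  submodule N -> kernel phi `<=` N -> (phi @` N) (phi u) -> N u.
Proof.
move=> subN kerN [n Nn /esym/kernel_sub/kerN Nun].
by rewrite -(subrK n u); apply: submoduleD.
Qed.

Lemma submodule_preimage {K : set M2} :
  submodule K -> submodule (phi @^-1` K).
Proof.
move=> /submoduleP[K0 KZD]; apply/submoduleP; split=> [|a u v Ku Kv] /=.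
- by rewrite linear0.
- by rewrite linearP; apply: KZD.
Qed.

Lemma submodule_image {N : set M1} : submodule N -> submodule (phi @` N).
Proof.
move=> /submoduleP[N0 NZD]; apply/submoduleP.
split=> [|a _ _ [u Nu <-] [v Nv <-]].
- by exists 0; rewrite ?linear0.
- by exists (a *: u + v); [apply: NZD | rewrite linearP].
Qed.

Lemma ideal_mul_image {I : set R} {u : M1} :
  ideal_mul I M1 u -> ideal_mul I M2 (phi u).
Proof.
move=> [n [a [x [Ia ->]]]]; exists n, a, (phi \o x); split=> //.
by rewrite linear_sum; apply: eq_bigr => i _; rewrite linearZ.
Qed.

Hypothesis phi_epi : range phi = [set: M2].

Lemma epi_onto (y : M2) : exists x, phi x = y.
Proof. by have : range phi y; [rewrite phi_epi | case=> x _ <-; exists x]. Qed.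

(** The vectors of the sum are lifted along [phi] by choice, while the coefficients in [I] stay the
    same. *)
Lemma ideal_mul_lift {I : set R} {y : M2} :
  ideal_mul I M2 y -> exists2 u, ideal_mul I M1 u & phi u = y.
Proof.
move=> [n [a [z [Ia ->]]]]; have [x xz] := choice (fun i => epi_onto (z i)).
exists (\sum_(i < n) a i *: x i); first by exists n, a, x.
by rewrite linear_sum; apply: eq_bigr => i _; rewrite linearZ /= xz.
Qed.

Lemma colon_ideal_mul_image (I : set R) :
  colon (ideal_mul I M1) `<=` colon (ideal_mul I M2).
Proof.
move=> r rI y; have [x <-] := epi_onto y.
by rewrite -linearZ; apply/ideal_mul_image/rI.
Qed.

Lemma colon_ideal_mul_lift (I : set R) :
  kernel phi `<=` ideal_mul I M1 ->
  colon (ideal_mul I M2) `<=` colon (ideal_mul I M1).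
Proof.
move=> kerI r rI x; have [u Iu /esym ux] := ideal_mul_lift (rI (phi x)).
rewrite -(subrK u (r *: x)); apply: ideal_mulD => //.
by apply/kerI/kernel_sub; rewrite linearZ.
Qed.

Lemma proper_preimage {K : set M2} :
  proper_submodule K -> proper_submodule (phi @^-1` K).
Proof.
move=> [subK neK]; split; first exact: submodule_preimage.
move=> KT; apply: neK; apply/seteqP; split=> // y _.
by have [x <-] := epi_onto y; rewrite -[K _]/((phi @^-1` K) x) KT.
Qed.

Lemma proper_image {N : set M1} :
  proper_submodule N -> kernel phi `<=` N -> proper_submodule (phi @` N).
Proof.
move=> [subN neN] kerN; split; first exact: submodule_image.
move=> NT; apply: neN; apply/seteqP; split=> // x _.
by apply: image_kernelP => //; rewrite NT.
Qed.

Lemma prime_preimage {P : set M2} :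
  prime_submodule P -> prime_submodule (phi @^-1` P).
Proof.
move=> [properP primeP]; split; first exact: proper_preimage.
move=> r m /=; rewrite linearZ => /primeP[Pm|Pr]; [by left | right=> x /=].
by rewrite linearZ; apply: Pr.
Qed.

Lemma prime_image {P : set M1} :
  prime_submodule P -> kernel phi `<=` P -> prime_submodule (phi @` P).
Proof.
move=> [properP primeP] kerP; split; first exact: proper_image.
move=> r y; have [m <-] := epi_onto y; rewrite -linearZ.
move=> /(image_kernelP properP.1 kerP)/primeP[Pm|Pr].
- by left; exists m.
- right=> z; have [x <-] := epi_onto z.
  by rewrite -linearZ; exists (r *: x).
Qed.

Lemma mrad_image {N : set M1} {m : M1} :
  mrad N m -> mrad (phi @` N) (phi m).
Proof.
move=> radm P [primeP NP]; apply: (radm (phi @^-1` P)); split.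
- exact: prime_preimage.
- by move=> n Nn; apply: NP; exists n.
Qed.

(** Each prime [P] over the preimage of [K] contains the kernel, because [K] contains 0. Its image
    is therefore a prime over [K], and [phi m] lying in that image puts [m] in [P]. *)
Lemma mrad_preimage {K : set M2} {m : M1} :
  submodule K -> mrad K (phi m) -> mrad (phi @^-1` K) m.
Proof.
move=> /submoduleP[K0 _] radm P [primeP KP].
have kerP : kernel phi `<=` P.
  by move=> x phix0; apply: KP; rewrite /= [phi x]phix0.
apply: (image_kernelP primeP.1.1 kerP); apply: radm; split.
- exact: prime_image.
- move=> y; have [x <-] := epi_onto y => Kx.
  by exists x => //; apply: KP.
Qed.

End Epimorphism.

Theorem proposition2 (R : comPzRingType) (M1 M2 : lmodType R)
    (phi : {linear M1 -> M2}) (phi_epi : range phi = [set: M2]) :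
  (forall N : set M1,
     quasi_J_submodule N -> kernel phi `<=` N ->
     quasi_J_submodule (phi @` N)) /\
  (forall K : set M2,
     quasi_J_submodule K -> kernel phi `<=` ideal_mul (jacobson R) M1 ->
     quasi_J_submodule (phi @^-1` K)).
Proof.
split=> [N [properN qJN] kerN|K [properK qJK] kerJ]; split.
- exact: proper_image.
- move=> r y; have [m <-] := epi_onto phi_epi y; rewrite -linearZ.
  move=> /(image_kernelP properN.1 kerN) Nrm nJr.
  apply: (mrad_image phi_epi); apply: qJN Nrm _.
  (* Contrapositive: a scalar outside the residual for [M2] is outside the one for [M1]. *)
  by move=> /(colon_ideal_mul_image phi_epi).
- exact: proper_preimage.
- move=> r m /=; rewrite linearZ => Krm nJr.
  apply: (mrad_preimage phi_epi properK.1); apply: qJK Krm _.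
  (* Here the residuals are compared in the opposite direction, which is where [kerJ] enters. *)
  by move=> /(colon_ideal_mul_lift phi_epi _ kerJ).
Qed.
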